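(* Let $n,k$ be positive integers with $n>2k$. Then $\beta(P(n,k)) \leq n+\left\lceil \frac{n}{5}\right\rceil$ holds in each of the following cases: (a) $k\in\{1,2,3,4,5\}$; (b) $n$ is even and $k$ is odd; (c) $n$ and $k$ are odd and $n\geq \frac{5(k+1)}{2}$; (d) $n$ and $k$ are even; (e) $n$ is odd, $k$ is even and $n>3k$.
   Context: For positive integers $n,k$ with $n>2k$, the generalized Petersen graph $P(n,k)$ is the graph with vertex set $\{u_i,v_i : i=1,\dots,n\}$ (so $2n$ vertices) and edge set $\{u_iu_{i+1},\ u_iv_i,\ v_iv_{i+k} : i=1,\dots,n\}$, subscripts being reduced modulo $n$. For a graph $G$, $\beta(G)$ denotes the minimum size of a vertex cover of $G$, i.e. of a set of vertices containing at least one endpoint of every edge. The inequality $\beta(P(n,k)) \leq n+\lceil n/5\rceil$ for all $n>2k$ is known as the Behsaz–Hatami–Mahmoodian conjecture. Since $\alpha(G)+\beta(G)=|V(G)|$, where $\alpha(G)$ is the independence number, it is equivalent to $\alpha(P(n,k))\geq \lfloor 4n/5\rfloor$. *)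

(* Defs.v *)
From mathcomp Require Import all_boot all_order all_algebra.

Set Implicit Arguments.
Unset Strict Implicit.
Unset Printing Implicit Defensive.

(* A simple graph on a finite type is given by its adjacency relation. *)

Definition vertex_cover (T : finType) (e : rel T) (S : {set T}) : bool :=
  [forall x, forall y, e x y ==> (x \in S) || (y \in S)].

Definition vertex_cover_number (T : finType) (e : rel T) : nat :=
  #|[arg min_(S < [set: T] | vertex_cover e S) #|S|]|.

(* The two summands hold the u_i and the v_i respectively; the indices are
   0, ..., n - 1 in place of 1, ..., n, as representatives modulo n. *)
Definition petersen_vertex (n : nat) : finType := ('I_n + 'I_n)%type.

Definition petersen (n k : nat) : rel (petersen_vertex n) :=
  fun x y => match x, y with
  | inl i, inl j => (j == i.+1 %% n :> nat) || (i == j.+1 %% n :> nat)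
  | inl i, inr j | inr i, inl j => i == j
  | inr i, inr j => (j == (i + k) %% n :> nat) || (i == (j + k) %% n :> nat)
  end.
Arguments petersen : clear implicits.

(* The default element of the arg min is itself a vertex cover, so the arg min
   really is one of least size. *)
Lemma vertex_coverT (T : finType) (e : rel T) : vertex_cover e [set: T].
Proof. by apply/forallP => x; apply/forallP => y; rewrite in_setT implybT. Qed.

Lemma petersen_sym (n k : nat) : symmetric (petersen n k).
Proof. by move=> [i|i] [j|j] //=; rewrite ?(eq_sym i) // orbC. Qed.

Lemma petersen_irr (n k : nat) :
  0 < k -> 2 * k < n -> irreflexive (petersen n k).
Proof.
move=> k0 kn.
have ne (d : nat) (i : 'I_n) : 0 < d < n -> (i == (i + d) %% n :> nat) = false.
  move=> /andP[d0 dn]; apply/negP => /eqP h.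
  have : i + d == i + 0 %[mod n] by rewrite -h addn0 modn_small.
  by rewrite eqn_modDl mod0n modn_small // eqn0Ngt d0.
have kn' : k < n by apply: leq_ltn_trans kn; rewrite leq_pmull.
case=> i /=; first by rewrite -addn1 !ne //=; apply: leq_ltn_trans kn'.
by rewrite !ne // k0.
Qed.

(* Main.v *)
(** The vertices are split into the columns [{u_i, v_i}]. A word over [{u, v}]
    of length [n] selects one vertex from each column, and the other vertices
    form a vertex cover once one column is added for each conflict ([u] at
    neighbouring positions, [v] at distance [k]). So it suffices to find words
    which can be repaired at about [n / 5] columns. For odd [k] the alternating
    word has conflicts only where the indices wrap around. For [k = 2] the word
    has period 5. For even [k > 2] one alternates in blocks of length [k],
    shifting the phase at each block; this costs one column per [2 k], and at
    most about [k / 2] columns at the wrap-around. *)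

Require Import Defs.
From mathcomp Require Import all_boot all_order all_algebra.
From mathcomp Require Import zify.

Lemma vertex_cover_number_le (T : finType) (e : rel T) (S : {set T}) :
  vertex_cover e S -> vertex_cover_number e <= #|S|.
Proof.
rewrite /vertex_cover_number => cS.
by case: arg_minnP => [|M _ minM]; [exact: vertex_coverT|exact: minM].
Qed.

Lemma card_ord_mem_le (n : nat) (Z : seq nat) :
  #|[pred i : 'I_n | (i : nat) \in Z]| <= size Z.
Proof.
rewrite cardE -(size_map val); apply: uniq_leq_size.
  by rewrite map_inj_uniq ?enum_uniq //; exact: val_inj.
by move=> x /mapP[i]; rewrite mem_enum inE => iZ ->.
Qed.

(* The column [{u_i, v_i}] meets the complement of the cover in [u_i] if [s i]
   holds, in [v_i] otherwise, and not at all if [i \in Z]. *)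
Lemma petersen_cover_le (n k : nat) (s : nat -> bool) (Z : seq nat) :
  (forall i, i < n -> s i -> s (i.+1 %% n) -> (i \in Z) || (i.+1 %% n \in Z)) ->
  (forall i, i < n -> ~~ s i -> ~~ s ((i + k) %% n) ->
    (i \in Z) || ((i + k) %% n \in Z)) ->
  vertex_cover_number (petersen n k) <= n + size Z.
Proof.
move=> hU hV.
pose S : {set petersen_vertex n} := [set x : petersen_vertex n | match x with
  | inl i => ~~ s i || ((i : nat) \in Z)
  | inr i => s i || ((i : nat) \in Z) end].
have cS : vertex_cover (petersen n k) S.
  apply/forallP => x; apply/forallP => y; apply/implyP.
  rewrite !inE; case: x y => [i|i] [j|j] /=.
  - case/orP => /eqP e.
      have := hU i (ltn_ord i); rewrite -e.
      by case: (s i); case: (s j); rewrite ?orbT //= => /(_ isT isT).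
    have := hU j (ltn_ord j); rewrite -e orbC.
    by case: (s i); case: (s j); rewrite ?orbT //= => /(_ isT isT).
  - by move=> /eqP ->; case: (s j); rewrite ?orbT.
  - by move=> /eqP ->; case: (s j); rewrite ?orbT.
  - case/orP => /eqP e.
      have := hV i (ltn_ord i); rewrite -e.
      by case: (s i); case: (s j); rewrite ?orbT //= => /(_ isT isT).
    have := hV j (ltn_ord j); rewrite -e orbC.
    by case: (s i); case: (s j); rewrite ?orbT //= => /(_ isT isT).
apply: (leq_trans (vertex_cover_number_le _ _ _ cS)).
apply: leq_trans (_ : n + #|[pred i : 'I_n | (i : nat) \in Z]| <= _); last first.
  by rewrite leq_add2l card_ord_mem_le.
(* Both summands are added up column by column: a column has one vertex in [S], or two if its index
   lies in [Z]. *)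
rewrite -sum1_card big_mkcond /petersen_vertex big_sumType /= -big_split /=.
rewrite -[X in X + _](card_ord n) -!sum1_card [X in _ + X]big_mkcond -big_split /=.
by apply: leq_sum => i _; rewrite !inE; do 2!case: ifP; case: (s i); case: (_ \in Z).
Qed.

Lemma le_ceil_div5 (z n : nat) :
  5 * z <= n + 4 -> (z%:Z <= Num.ceil (n%:R / 5%:R : rat))%R.
Proof.
move=> zn; have := Num.Theory.ceil_ge (n%:R / 5%:R : rat)%R.
rewrite Num.Theory.ler_pdivrMr // => h.
have : (n%:Z <= Num.ceil (n%:R / 5%:R : rat) * 5)%R.
  by rewrite -(ler_int rat) GRing.rmorphM.
by lia.
Qed.

(** For even [n], reduction modulo [n] preserves parity and nothing needs repair. For odd [n], the
    [v]-conflicts start at the even indices of [[n - k, n)], which [Z] lists. *)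
Lemma petersen_odd (n k : nat) :
  odd k -> k <= n ->
  vertex_cover_number (petersen n k) <= n + odd n * k.+1./2.
Proof.
move=> ok kn.
pose Z := if odd n then [seq n - k + t.*2 | t <- iota 0 k.+1./2] else [::].
have -> : odd n * k.+1./2 = size Z.
  by rewrite /Z; case: (odd n); rewrite ?size_map ?size_iota ?mul1n.
apply: (petersen_cover_le _ _ odd) => i i_n.
  case: (ltngtP i.+1 n) => [lt|gt|->]; last by rewrite modnn.
    by rewrite modn_small //=; case: (odd i).
  by lia.
case: (ltnP (i + k) n) => [lt|ge].
  by rewrite modn_small // oddD ok; case: (odd i).
have -> : (i + k) %% n = i + k - n.
  by rewrite -[in LHS](subnK ge) modnDr modn_small //; lia.
rewrite oddB // oddD ok => ei; rewrite (negbTE ei) /= => on.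
rewrite /Z; case: ifP on => [on _|//].
apply/orP; left; apply/mapP; exists ((i - (n - k))./2); last by lia.
by rewrite mem_iota; lia.
Qed.

Lemma petersen_2 (n : nat) :
  4 < n -> vertex_cover_number (petersen n 2) <= n + (n.-1 %/ 5).+1.
Proof.
move=> n4.
(* In the word [u v v u u] repeated, every conflict involves a residue 4. Column [n.-1] settles the
   wrap-around: the one other wrapping edge, from [v_{n-2}], ends in column 0, which selects [u]. *)
pose Z := n.-1 :: [seq 5 * b + 4 | b <- iota 0 (n.-1 %/ 5)].
have -> : (n.-1 %/ 5).+1 = size Z by rewrite /= size_map size_iota.
have ZP i : i < n -> i %% 5 = 4 -> i \in Z.
  move=> i_n i4; rewrite inE; case: eqP => //= ne.
  apply/mapP; exists (i %/ 5); last by lia.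
  by rewrite mem_iota; lia.
have Zn : n.-1 \in Z by rewrite inE eqxx.
apply: (petersen_cover_le _ _ (fun i => (i %% 5 == 0) || (2 < i %% 5))) => i i_n.
  case: (ltngtP i.+1 n) => [lt|gt|e]; [|by lia|].
    rewrite [i.+1 %% n]modn_small //= => h1 h2.
    have [i4|i4] : i %% 5 = 4 \/ i.+1 %% 5 = 4 by lia.
      by rewrite ZP.
    by rewrite (ZP i.+1) ?orbT.
  have -> : i = n.-1 by lia.
  by rewrite Zn.
case: (ltnP (i + 2) n) => [lt|ge].
  by rewrite [(i + 2) %% n]modn_small //= => h1 h2; lia.
have [->|e] : i = n.-1 \/ i + 2 = n by lia.
  by rewrite Zn.
by rewrite e modnn.
Qed.

(** Here [petersen_even] would spend three columns, one too many. *)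
Lemma petersen_9_4 : vertex_cover_number (petersen 9 4) <= 11.
Proof.
apply: (petersen_cover_le 9 4 (fun i => i \in [:: 0; 2; 5; 7]) [:: 6; 8]);
  by do 10![case=> //].
Qed.

(* Columns [u, v, u, v, ...] on each interval [2bk, (2b+1)k), and [v, u, v, u, ...]
   on each [(2b+1)k, (2b+2)k): as [k] is even, the only conflicts are those
   between [u_{2bk-1}] and [u_{2bk}] and those created by the reduction
   modulo [n]. *)
Lemma petersen_even (n k : nat) :
  0 < k -> ~~ odd k -> k <= n ->
  vertex_cover_number (petersen n k) <=
    n + (~~ odd (n.-1 + n.-1 %/ k) + n.-1 %/ k.*2 +
         (if odd (n + n %/ k) then (k - n %% k)./2
          else k./2 - (k - n %% k)./2)).
Proof.
move=> k0 ek kn.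
set m := ~~ _; set c := (k - n %% k)./2.
(* The wrapping edge into [v_j], [j] odd, starts in block [n %/ k - 1] if [j < k - n %% k], else in
   block [n %/ k]. These have opposite phases, so only one of the two ranges of [j] conflicts; [c]
   counts the odd [j] in the first. *)
pose o := if odd (n + n %/ k) then iota 0 c else iota c (k./2 - c).
pose Z := nseq m 0 ++ [seq b * k.*2 | b <- iota 1 (n.-1 %/ k.*2)] ++
          [seq t.*2.+1 | t <- o].
have -> : m + n.-1 %/ k.*2 + (if odd (n + n %/ k) then c else k./2 - c) = size Z.
  by rewrite /Z /o !size_cat size_nseq !size_map size_iota; case: ifP;
    rewrite size_iota addnA.
have divS i : i.+1 %/ k = i %/ k + (k %| i.+1) by rewrite divnS // addnC.
have hn := divn_eq n k.
apply: (petersen_cover_le _ _ (fun i => ~~ odd (i + i %/ k))) => i i_n.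
  case: (ltngtP i.+1 n) => [lt|gt|e]; [|by lia|].
    rewrite modn_small // divS; case: dvdnP => [[b eb]|_] /=; last by lia.
    rewrite eb => h1 h2; apply/orP; right.
    have ebk : ~~ odd (b * k) by rewrite oddM (negbTE ek) andbF.
    have ib : i %/ k + 1 = b by have := divS i; rewrite eb mulnK // dvdn_mull.
    have eb2 : b = b./2.*2 by lia.
    have bk : b./2 * k.*2 = b * k by rewrite [in RHS]eb2 -!muln2; lia.
    rewrite !mem_cat; apply/orP; right; apply/orP; left.
    apply/mapP; exists b./2; last by rewrite bk.
    rewrite mem_iota add1n ltnS leq_divRL ?double_gt0 // bk.
    by lia.
  rewrite e modnn => h _; apply/orP; right.
  have ei : i = n.-1 by lia.
  by rewrite !mem_cat /m -ei h.
case: (ltnP (i + k) n) => [lt|ge].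
  rewrite modn_small // divnDr ?dvdnn // divnn k0.
  by move: (i %/ k) => d; lia.
have -> : (i + k) %% n = i + k - n.
  by rewrite -[in LHS](subnK ge) modnDr modn_small //; lia.
move ej : (i + k - n) => j.
have jk : j < k by lia.
rewrite [j %/ k]divn_small // addn0 !negbK => h oj; apply/orP; right.
rewrite !mem_cat; apply/orP; right; apply/orP; right.
apply/mapP; exists j./2; last by lia.
have q0 : 0 < n %/ k by rewrite divn_gt0.
have rk : n %% k < k by rewrite ltn_mod.
move: h; case: (ltnP (n %% k + j) k) => [lt|ge'].
  have -> : i %/ k = (n %/ k).-1.
    have -> : i = (n %/ k).-1 * k + (n %% k + j).
      by move: hn; case: (n %/ k) q0 => // q _; rewrite mulSn /=; lia.
    by rewrite divnMDl // (divn_small lt) addn0.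
  by rewrite /o; case: ifP => on h; rewrite mem_iota; lia.
have -> : i %/ k = n %/ k.
  have -> : i = n %/ k * k + (n %% k + j - k) by lia.
  by rewrite divnMDl // [(_ - k) %/ k]divn_small ?addn0; lia.
by rewrite /o; case: ifP => on h; rewrite mem_iota; lia.
Qed.

(** The condition on odd [n] is what [2 * k < n < 3 * k] demands: for [k = 2h] and [n = 2k + 2t + 1]
    the count is [h - t + 1], which fits exactly when [h <= 7t]. *)
Lemma petersen_even_bound (n k : nat) :
  3 < k -> ~~ odd k -> 2 * k < n -> (odd n -> 15 * k + 5 < 7 * n) ->
  5 * (~~ odd (n.-1 + n.-1 %/ k) + n.-1 %/ k.*2 +
       (if odd (n + n %/ k) then (k - n %% k)./2
        else k./2 - (k - n %% k)./2)) <= n + 4.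
Proof.
move=> k3 ek n2k on.
have k0 : 0 < k by lia.
have p2 : 1 < n.-1 %/ k by rewrite leq_divRL //; lia.
have sk : n.-1 %% k < k by rewrite ltn_mod.
have := divn_eq n.-1 k.
rewrite -[k.*2]muln2 divnMA.
move: (n.-1 %/ k) (n.-1 %% k) p2 sk => [|[|p]] s // _ sk en.
have [h eh] : exists h, k = h.*2 by exists k./2; lia.
(* To stay linear, the product [p * h] is kept only through [(p - 1)(h - 2) >= 0] for positive
   [p]. *)
have hp : if p is p'.+1 then p'.*2 + h <= p * h else p * h = 0.
  case: (p) => [|p'] //; rewrite mulSn addnC leq_add2l -muln2 leq_mul2l; lia.
have epk : p.+2 * k = (p * h).*2 + k.*2 by rewrite eh -!muln2; lia.
move: (p * h) hp epk => x hp epk.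
have {}hp : p = 0 /\ x = 0 \/ 0 < p /\ 2 * p + h <= x + 2 by case: (p) hp; lia.
(* The quotients of [n.-1] and [n] by [k] differ only if [k] divides [n]. *)
have [sk'|sk'] : s.+1 < k \/ s.+1 = k by lia.
  have -> : n = p.+2 * k + s.+1 by lia.
  rewrite divnMDl // modnMDl (divn_small sk') (modn_small sk') addn0 epk.
  have : n = x.*2 + k.*2 + s.+1 by lia.
  clear en epk => en.
  have -> : (x.*2 + k.*2 + s.+1).-1 = x.*2 + k.*2 + s by lia.
  rewrite !oddD !odd_double /=.
  have -> : k./2 = h by lia.
  have -> : (k - s.+1)./2 = h - (s./2).+1 by lia.
  have on' : ~~ odd s -> 15 * k + 5 < 7 * n by move=> os; apply: on; lia.
  have [c ep] : exists c, p = c.*2 \/ p = c.*2.+1 by exists p./2; lia.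
  have [t es] : exists t, s = t.*2 \/ s = t.*2.+1 by exists s./2; lia.
  have -> : s./2 = t by lia.
  clear on; case: ep es on' => ep [] es; subst p s;
    rewrite /= ?negbK !odd_double /= => on; lia.
have -> : n = p.+3 * k + 0 by rewrite mulSn; lia.
rewrite divnMDl // modnMDl div0n mod0n subn0 !addn0 [p.+3 * k]mulSn epk.
by case: ifP; lia.
Qed.

Theorem theorem4 (n k : nat) (k_gt0 : 0 < k) (n_gt2k : 2 * k < n) :
  k \in [:: 1; 2; 3; 4; 5] \/
  (~~ odd n /\ odd k) \/
  (odd n /\ odd k /\ (5%:R * (k%:R + 1) / 2%:R <= n%:R :> rat)%R) \/
  (~~ odd n /\ ~~ odd k) \/
  (odd n /\ ~~ odd k /\ 3 * k < n) ->
  ((vertex_cover_number (petersen n k))%:Z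
     <= n%:Z + Num.ceil (n%:R / 5%:R : rat))%R.
Proof.
move=> hyp.
suff [z zn le_z] : exists2 z, 5 * z <= n + 4 &
    vertex_cover_number (petersen n k) <= n + z.
  by have := le_ceil_div5 _ _ zn; lia.
have {}hyp : k \in [:: 1; 2; 3; 4; 5] \/
    (odd n -> if odd k then 5 * k.+1 <= 2 * n else 3 * k < n).
  case: hyp => [|[[en ok]|[[on [ok h]]|[[en ek]|[on [ek h]]]]]]; [by left| | | |];
    right.
  - by rewrite ok (negbTE en).
  - rewrite ok => _.
    move: h; rewrite Num.Theory.ler_pdivrMr // -[1%R]/(1%:R)%R.
    by rewrite -!GRing.natrD -!GRing.natrM Num.Theory.ler_nat addn1 mulnC; lia.
  - by rewrite (negbTE ek) (negbTE en).
  - by rewrite (negbTE ek).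
case: ifP hyp => [ok|ek] hyp.
  exists (odd n * k.+1./2).
    by case: hyp => [|hyp]; [rewrite !inE; lia | case: odd hyp; lia].
  by apply: petersen_odd => //; lia.
(* Blocks of length 2 would cost one column in four. *)
have [k2|k2] := eqVneq k 2.
  exists (n.-1 %/ 5).+1; first by lia.
  by rewrite k2; apply: petersen_2; lia.
(* For [k = 4] and odd [n > 8], the inequality fails only at [n = 9]. *)
have [[-> ->]|nk] : (n = 9 /\ k = 4) \/ (odd n -> 15 * k + 5 < 7 * n).
- by case: hyp => [|hyp]; [rewrite !inE; lia | right=> /hyp; lia].
- by exists 2 => //; exact: petersen_9_4.
- eexists; last by apply: petersen_even => //; lia.
  by apply: petersen_even_bound => //; lia.
Qed.
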